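(* In the setting described in the context, after rescaling the variable $z$ (replacing $z$ by $\alpha(r)z$ with $\alpha(r):=-\omega(r)/p(r)$; the rescaled variable is again denoted $z$), the return map along $I$ takes the form $$\begin{pmatrix}z\\ r\\ \phi\end{pmatrix}\mapsto\begin{pmatrix}\Omega(r,\phi)+\Gamma(r,\phi)\,z+O(z\,e^z)\\ b_0(r,\phi)+O(e^z)\\ c(r,\phi)+z+O(z\,e^z)\pmod 1\end{pmatrix},$$ where $$\Omega(r,\phi):=-\frac{\omega(b_0(r,\phi))}{p(b_0(r,\phi))}\cdot\ln(a_1(r,\phi))\cdot\frac{-\varsigma(b_0(r,\phi))}{p(b_0(r,\phi))},\qquad \Gamma(r,\phi):=\frac{-\varsigma(b_0(r,\phi))}{p(b_0(r,\phi))},$$ $$c(r,\phi):=c_0(r,\phi)-\frac{\omega(b_0(r,\phi))}{p(b_0(r,\phi))}\cdot\ln(a_1(r,\phi)).$$ In the error terms $O(z\,e^z)$ and $O(e^z)$, $z$ stands for the original variable $\ln(v_2/h)\to-\infty$.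
   Context: Setting. A real analytic system $\dot x=F(x)$ in $\mathbb R^4$ has a saddle-center at $0$ with a two-dimensional compact center manifold $D=W^c(0)$ foliated by periodic orbits, and the three-dimensional stable and unstable manifolds of $D$ coincide, forming a non-transverse homoclinic channel $I$. Near $D$ there are analytic coordinates $(v_1,v_2,r,\phi)$, with $(r,\phi)$ polar coordinates on $D=\{v_1=v_2=0\}$, $r\in[0,1]$, $\phi$ taken mod $1$, in which the system reads $$\dot v_1=p(r)v_1+p_0v_1^2v_2,\quad \dot v_2=\varsigma(r)v_2+\varsigma_0v_1v_2^2,\quad \dot r=v_1v_2r_0,\quad \dot\phi=\omega(r)+v_1v_2\omega_0,$$ where $p_0,\varsigma_0,r_0,\omega_0$ are analytic functions of $(v_1,v_2,r,\phi)$, $1$-periodic in $\phi$. Standing assumption: $p(r)>0$, $\varsigma(r)<0$, $p(r)+\varsigma(r)<0$ for all $r$. For small $h>0$ let $S_1=\{v_1=h\}$ (coordinates $(v_2,r,\phi)$) and $S_2=\{v_2=h\}$ (coordinates $(v_1,r,\phi)$). $loc:S_2\to S_1$ is the local map given by the flow near $D$. $glob:S_1\to S_2$ is the global map along $I$, assumed analytic, with expansion $$glob(v_2,r,\phi)=\big(a_1(r,\phi)v_2,\ b_0(r,\phi)+b_1(r,\phi)v_2,\ c_0(r,\phi)+c_1(r,\phi)v_2\big)+\text{higher order terms in }v_2.$$ The return map is $loc\circ glob:S_1\to S_1$; before rescaling it is written in the coordinates $(z,r,\phi)$, $z=\ln(v_2/h)$, $v_2>0$ small. $a_1,b_0,c_0$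 are $1$-periodic in $\phi$.
   Formalization: The rescaled variable of the source point is taken as α(b_0(r,φ))z instead of α(r)z (the image is rescaled with α at its own radius); with α(r)z at the source the displayed formula is false unless α(b_0(r,φ)) = α(r). *)

(* Defs.v *)
From HB Require Import structures.
From mathcomp Require Import all_boot all_order all_algebra.
From mathcomp Require Import all_classical all_reals all_analysis.

Set Implicit Arguments.
Unset Strict Implicit.
Unset Printing Implicit Defensive.

Import Order.TTheory GRing.Theory Num.Theory.
Import numFieldNormedType.Exports.

Local Open Scope classical_set_scope.
Local Open Scope ring_scope.

Definition pt1 (R : realType) (a : R) : 'rV[R]_1 := \row_(i < 1) a.

Definition pt3 (R : realType) (a b c : R) : 'rV[R]_3 :=
  \row_(i < 3) [:: a; b; c]`_i.

Definition pt4 (R : realType) (a b c d : R) : 'rV[R]_4 :=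
  \row_(i < 4) [:: a; b; c; d]`_i.

Definition monomial (R : realType) (n : nat) (u : 'rV[R]_n)
    (m : {ffun 'I_n -> nat}) : R :=
  \prod_(i < n) u 0 i ^+ m i.

(* The sum of F over the multi-indices with all entries below N; for an
   absolutely convergent multiple series the limit over these boxes is its
   sum. *)
Definition box_sum (R : realType) (n : nat) (F : {ffun 'I_n -> nat} -> R)
    (N : nat) : R :=
  \sum_(m : {ffun 'I_n -> 'I_N}) F [ffun i => nat_of_ord (m i)].

(* f is real analytic at x: on a polydisc around x it is the sum of an
   absolutely convergent power series (the norm of 'rV[R]_n is the sup norm). *)
Definition analytic_at (R : realType) (n : nat) (f : 'rV[R]_n -> R)
    (x : 'rV[R]_n) : Prop :=
  exists (a : {ffun 'I_n -> nat} -> R) (rho : R), 0 < rho /\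
    forall u : 'rV[R]_n, (forall i, `|u 0 i| < rho) ->
      cvgn (box_sum (fun m => `|a m * monomial u m|)) /\
      box_sum (fun m => a m * monomial u m) @ \oo --> f (x + u).

Definition analytic1_at (R : realType) (f : R -> R) (x : R) : Prop :=
  analytic_at (fun u : 'rV[R]_1 => f (u 0 0)) (pt1 x).

Definition eq_mod1 (R : realType) (x y : R) : Prop :=
  exists k : int, x = y + k%:~R.

(* The coefficients of the system; [sg] stands for varsigma.  The functions are
   total, but only their values near D = {v1 = v2 = 0, 0 <= r <= 1} matter. *)
Record coefs (R : realType) := Coefs {
  p : R -> R;
  sg : R -> R;
  omega : R -> R;
  p0 : 'rV[R]_4 -> R;
  sg0 : 'rV[R]_4 -> R;
  r0 : 'rV[R]_4 -> R;
  omega0 : 'rV[R]_4 -> R }.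

Definition vfield (R : realType) (S : coefs R) (x : 'rV[R]_4) : 'rV[R]_4 :=
  let v1 := x 0 0 in let v2 := x 0 1 in let r := x 0 2 in
  pt4 (p S r * v1 + p0 S x * v1 ^+ 2 * v2)
      (sg S r * v2 + sg0 S x * v1 * v2 ^+ 2)
      (v1 * v2 * r0 S x)
      (omega S r + v1 * v2 * omega0 S x).

Definition analytic_on_D (R : realType) (f : 'rV[R]_4 -> R) : Prop :=
  forall r phi : R, 0 <= r <= 1 -> analytic_at f (pt4 0 0 r phi).

Definition periodic_in_phi (R : realType) (f : 'rV[R]_4 -> R) : Prop :=
  forall v1 v2 r phi : R, f (pt4 v1 v2 r (phi + 1)) = f (pt4 v1 v2 r phi).

Record normal_form (R : realType) (S : coefs R) : Prop := NormalForm {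
  nf_analytic1 : forall r : R, 0 <= r <= 1 ->
    [/\ analytic1_at (p S) r, analytic1_at (sg S) r
      & analytic1_at (omega S) r];
  nf_analytic4 : [/\ analytic_on_D (p0 S), analytic_on_D (sg0 S),
    analytic_on_D (r0 S) & analytic_on_D (omega0 S)];
  nf_periodic : [/\ periodic_in_phi (p0 S), periodic_in_phi (sg0 S),
    periodic_in_phi (r0 S) & periodic_in_phi (omega0 S)];
  nf_signs : forall r : R, 0 <= r <= 1 ->
    [/\ 0 < p S r, sg S r < 0 & p S r + sg S r < 0];
  (* D is foliated by periodic orbits *)
  nf_omega : forall r : R, 0 <= r <= 1 -> omega S r != 0 }.

Definition near_D (R : realType) (h : R) (x : 'rV[R]_4) : Prop :=
  [/\ `|x 0 0| <= h, `|x 0 1| <= h & - h <= x 0 2 <= 1 + h].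

Definition trajectory (R : realType) (S : coefs R) (T : R)
    (x : R -> 'rV[R]_4) : Prop :=
  forall t : R, 0 <= t <= T -> forall i : 'I_4,
    is_derive t (1 : R) (fun s : R => x s 0 i : R) (vfield S (x t) 0 i).

(* The orbit of q = (v1, r, phi) in S_2 = {v2 = h}, staying near D, meets
   S_1 = {v1 = h} at q' = (v2, r, phi).  The hit is unique: v1 increases
   along such orbits when h is small and v1 > 0. *)
Definition passage (R : realType) (S : coefs R) (h : R) (q q' : 'rV[R]_3) :
    Prop :=
  exists (T : R) (x : R -> 'rV[R]_4),
    [/\ 0 <= T, trajectory S T x, forall t : R, 0 <= t <= T -> near_D h (x t),
        x 0 = pt4 (q 0 0) h (q 0 1) (q 0 2)
      & [/\ x T 0 0 = h, x T 0 1 = q' 0 0, x T 0 2 = q' 0 1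
          & eq_mod1 (x T 0 3) (q' 0 2)]].

Definition local_map (R : realType) (S : coefs R) (h : R)
    (W : set 'rV[R]_3) (loc : 'rV[R]_3 -> 'rV[R]_3) : Prop :=
  forall q, W q -> passage S h q (loc q).

(* The channel is v2 = 0 in S_1 and v1 = 0 in S_2.  The angle is real-valued
   but only meaningful mod 1, whence the periodicity mod 1 of the third
   component of glob and of c0.  The logarithm of a1 requires a1 > 0. *)
Record global_map (R : realType) (glob : 'rV[R]_3 -> 'rV[R]_3)
    (a1 b0 b1 c0 c1 : R -> R -> R) : Prop := GlobalMap {
  glob_analytic : forall r phi : R, 0 <= r <= 1 -> forall i : 'I_3,
    analytic_at (fun q => glob q 0 i) (pt3 0 r phi);
  glob_periodic : forall v2 r phi : R,
    let q := glob (pt3 v2 r phi) in let q' := glob (pt3 v2 r (phi + 1)) in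
    [/\ q' 0 0 = q 0 0, q' 0 1 = q 0 1 & eq_mod1 (q' 0 2) (q 0 2)];
  glob_expansion : exists K d : R, 0 < d /\
    forall v2 r phi : R, `|v2| < d -> 0 <= r <= 1 ->
      let q := glob (pt3 v2 r phi) in
      [/\ `|q 0 0 - a1 r phi * v2| <= K * v2 ^+ 2,
          `|q 0 1 - (b0 r phi + b1 r phi * v2)| <= K * v2 ^+ 2
        & `|q 0 2 - (c0 r phi + c1 r phi * v2)| <= K * v2 ^+ 2];
  coef_periodic : forall r phi : R, 0 <= r <= 1 ->
    [/\ a1 r (phi + 1) = a1 r phi, b0 r (phi + 1) = b0 r phi
      & eq_mod1 (c0 r (phi + 1)) (c0 r phi)];
  a1_gt0 : forall r phi : R, 0 <= r <= 1 -> 0 < a1 r phi;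
  b0_itv : forall r phi : R, 0 <= r <= 1 -> 0 <= b0 r phi <= 1 }.

(* (z, r, phi) -> (v2, r, phi) with z = ln (v2 / h), and its inverse for
   v2 > 0. *)
Definition of_log (R : realType) (h : R) (q : 'rV[R]_3) : 'rV[R]_3 :=
  pt3 (h * expR (q 0 0)) (q 0 1) (q 0 2).

Definition to_log (R : realType) (h : R) (q : 'rV[R]_3) : 'rV[R]_3 :=
  pt3 (ln (q 0 0 / h)) (q 0 1) (q 0 2).

Definition return_map (R : realType) (h : R)
    (loc glob : 'rV[R]_3 -> 'rV[R]_3) : 'rV[R]_3 -> 'rV[R]_3 :=
  to_log h \o loc \o glob \o of_log h.

Definition alpha (R : realType) (S : coefs R) (r : R) : R :=
  - omega S r / p S r.

(* The radius r at which alpha is taken matters: for the return map it has to be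
   the radius of the local passage, which is b0 r phi at leading order, and not
   the radius of the point of S_1 from which glob starts. *)
Definition rescale (R : realType) (S : coefs R) (r z : R) : R :=
  alpha S r * z.

Definition Gamma (R : realType) (S : coefs R) (b0 : R -> R -> R) (r phi : R) :
    R :=
  - sg S (b0 r phi) / p S (b0 r phi).

Definition Omega (R : realType) (S : coefs R) (a1 b0 : R -> R -> R)
    (r phi : R) : R :=
  - (omega S (b0 r phi) / p S (b0 r phi)) * ln (a1 r phi)
    * (- sg S (b0 r phi) / p S (b0 r phi)).

Definition c_shift (R : realType) (S : coefs R) (a1 b0 c0 : R -> R -> R)
    (r phi : R) : R :=
  c0 r phi - omega S (b0 r phi) / p S (b0 r phi) * ln (a1 r phi).

(* Main.v *)
Require Import Defs.
From HB Require Import structures.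
From mathcomp Require Import all_boot all_order all_algebra.
From mathcomp Require Import all_classical all_reals all_analysis.
From mathcomp Require Import ring lra.
Set Implicit Arguments.
Unset Strict Implicit.
Unset Printing Implicit Defensive.
Import Order.TTheory GRing.Theory Num.Theory.
Import numFieldNormedType.Exports.
Local Open Scope classical_set_scope.
Local Open Scope ring_scope.

(** The product u = v1 * v2 measures the distance of a local orbit from D's
    invariant manifolds, and it satisfies u' = u * (p + varsigma + O(u)).  Since
    p + varsigma < 0, u is positive at the entry and decays along the whole
    passage at a rate bounded away from 0, however long the passage lasts.  As r' = u * r0, the
    decay of u alone, without solving anything, shows that r stays within a
    multiple of u(0) of its initial value.  An orbit entering at v1 = V, v2 = h
    has u(0) = h * V, and V = a1 * v2 + O(v2 ^ 2) is O(e^z); hence during the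
    passage r = b0 + O(e^z), and ln v1, ln v2, phi have derivatives
    p(b0), varsigma(b0), omega(b0) up to O(e^z) ([trajectory_estimates]).

    The passage time T is read off ln v1, which has to grow from
    ln V = ln h + z + ln a1 + O(e^z) to ln h.  First T = O(|z|), then
    T = - (z + ln a1) / p(b0) + O(|z| e^z); substituting T in ln v2 and phi gives
    the three components of the image ([passage_asymptotics]).  Rescaling the
    image costs one more error term, because alpha is taken at the radius of the
    image point and multiplies a logarithm of size O(|z|); alpha is Lipschitz, so
    this is again O(|z| e^z) ([alpha_lipschitz]).

    The constants have to be uniform in r and phi.  A convergent power series is
    Lipschitz on a smaller polydisc ([analytic_lipschitz_near]), and compactness
    of [0, 1] in r and, by periodicity, in phi makes size, Lipschitz constant and
    positive lower bounds uniform ([box_uniform], [normal_form_local_bounds],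
    [global_map_bounds]).  Both glob and the local passage determine the angle
    only mod 1, which is where the integer in the third component comes from. *)

(** * Analytic functions are locally Lipschitz *)

(** Telescoping: replacing the factors one at a time, each replacement costs a
    relative error k i * e.  Relative errors are what makes the bound
    proportional to the dominating product. *)
Lemma ler_norm_prodB (R : realType) (I : Type) (s : seq I) (x y B k : I -> R)
    (e : R) :
  0 <= e -> (forall i, 0 <= k i) -> (forall i, 0 <= B i) ->
  (forall i, `|x i| <= B i) -> (forall i, `|y i| <= B i) ->
  (forall i, `|x i - y i| <= k i * e * B i) ->
  `|\prod_(i <- s) x i - \prod_(i <- s) y i|
    <= (\sum_(i <- s) k i) * e * \prod_(i <- s) B i.
Proof.
move=> e0 k0 B0 xB yB xyB; elim: s => [|i s IH].
  by rewrite !big_nil subrr normr0 !mul0r.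
rewrite !big_cons.
set X := \prod_(j <- s) x j; set Y := \prod_(j <- s) y j.
set P := \prod_(j <- s) B j; set K := \sum_(j <- s) k j.
have -> : x i * X - y i * Y = x i * (X - Y) + (x i - y i) * Y by ring.
have YP : `|Y| <= P.
  by rewrite normr_prod; apply: ler_prod => j _; rewrite normr_ge0 yB.
apply: (le_trans (ler_normD _ _)); rewrite !normrM.
have h1 : `|x i| * `|X - Y| <= B i * (K * e * P) by apply: ler_pM.
have h2 : `|x i - y i| * `|Y| <= (k i * e * B i) * P by apply: ler_pM.
by apply: (le_trans (lerD h1 h2)); rewrite le_eqVlt; apply/orP; left; apply/eqP; ring.
Qed.

Lemma ler_norm_exprB (R : realType) (r x y e : R) (k : nat) :
  0 < r -> `|x| <= r -> `|y| <= r -> `|x - y| <= e ->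
  `|x ^+ k - y ^+ k| <= k%:R * (e / r) * r ^+ k.
Proof.
move=> r0 xr yr xye; have e0 : 0 <= e by apply: le_trans xye.
have := @ler_norm_prodB R nat (index_iota 0 k) (fun=> x) (fun=> y) (fun=> r)
  (fun=> 1) (e / r).
rewrite !prodr_const_nat sumr_const_nat subn0; apply=> // [|_|_].
- by rewrite divr_ge0 // ltW.
- exact: ltW.
- by rewrite mul1r divfK ?gt_eqF.
Qed.

(** The bound on the right is a monomial again, at twice the radius: the degree
    that appears when a monomial is differentiated is absorbed by 2 ^ degree.
    Summed over a power series it is thus controlled by the absolute convergence
    at the larger radius. *)
Lemma ler_norm_monomialB (R : realType) (n : nat) (r e : R) (u v : 'rV[R]_n)
    (m : {ffun 'I_n -> nat}) :
  0 < r -> 0 <= e -> (forall i, `|u 0 i| <= r) -> (forall i, `|v 0 i| <= r) ->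
  (forall i, `|u 0 i - v 0 i| <= e) ->
  `|monomial u m - monomial v m|
    <= e / r * monomial (const_mx (2 * r) : 'rV[R]_n) m.
Proof.
move=> r0 e0 ur vr uve; rewrite /monomial.
have er : 0 <= e / r by rewrite divr_ge0 // ltW.
have := @ler_norm_prodB R 'I_n (index_enum 'I_n) (fun i => u 0 i ^+ m i)
  (fun i => v 0 i ^+ m i) (fun i => r ^+ m i) (fun i => (m i)%:R) (e / r) er.
move=> H; apply: le_trans (H _ _ _ _ _) _ => [i|i|i|i|i|] //.
- by rewrite exprn_ge0 // ltW.
- by rewrite normrX lerXn2r // ?nnegrE // ltW.
- by rewrite normrX lerXn2r // ?nnegrE // ltW.
- exact: ler_norm_exprB.
have -> : \prod_(i < n) (const_mx (2 * r) : 'rV[R]_n) 0 i ^+ m i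
    = 2 ^+ (\sum_(i < n) m i) * \prod_(i < n) r ^+ m i.
  by rewrite -prodrXr -big_split; apply: eq_bigr => i _; rewrite mxE exprMn.
rewrite -natr_sum [leRHS]mulrA; apply: ler_wpM2r.
  by apply: prodr_ge0 => i _; rewrite exprn_ge0 // ltW.
rewrite mulrC; apply: ler_wpM2l => //.
by rewrite -natrX ler_nat ltnW // ltn_expl.
Qed.

(** The single number d is the radius, the inverse of the Lipschitz constant and
    the inverse of the bound, so that the property persists when d decreases and
    [box_uniform] applies. *)
Definition lipschitz_near (R : realType) (n : nat) (f : 'rV[R]_n -> R) (d : R)
    (x : 'rV[R]_n) : Prop :=
  forall (u v : 'rV[R]_n) (e : R), 0 <= e ->
    (forall i, `|u 0 i| < d) -> (forall i, `|v 0 i| < d) ->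
    (forall i, `|u 0 i - v 0 i| <= e) ->
    `|f (x + u)| <= d^-1 /\ `|f (x + u) - f (x + v)| <= d^-1 * e.

Lemma cvg_norm_le (R : realType) (u : nat -> R) (l B : R) :
  u @ \oo --> l -> (forall N, `|u N| <= B) -> `|l| <= B.
Proof.
move=> ul uB; have cn : (fun N => `|u N|) @ \oo --> `|l| by exact: cvg_norm.
rewrite -(cvg_lim (@Rhausdorff R) cn); apply: limr_le.
  by apply/cvg_ex; exists `|l|.
by near=> N; exact: uB.
Unshelve. all: by end_near.
Qed.

(** Term by term, the increments of the series on the polydisc of radius r are
    dominated by the absolute series at radius 2 * r, whose partial sums are
    bounded; the bound survives in the limit. *)
Lemma analytic_lipschitz_near (R : realType) (n : nat) (f : 'rV[R]_n -> R)
    (x : 'rV[R]_n) :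
  analytic_at f x -> exists2 d : R, 0 < d & lipschitz_near f d x.
Proof.
move=> [a [rho [rho0 Ha]]].
(* the series converges absolutely at 2 * r, one half of rho *)
set r := rho / 4; have r0 : 0 < r by rewrite /r; lra.
pose w : 'rV[R]_n := const_mx (2 * r).
have [cw _] : cvgn (box_sum (fun m => `|a m * monomial w m|)) /\
    box_sum (fun m => a m * monomial w m) @ \oo --> f (x + w).
  by apply: Ha => i; rewrite mxE gtr0_norm /r; lra.
have [M [_ HM]] := cvg_seq_bounded cw.
set B := `|M| + 1; have B1 : 1 <= B by rewrite /B; have := normr_ge0 M; lra.
have {HM} HB N : box_sum (fun m => `|a m * monomial w m|) N <= B.
  apply: le_trans (ler_norm _) (HM B _ N I).
  by rewrite /B; have := ler_norm M; lra.
have w0 m : 0 <= monomial w m.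
  by apply: prodr_ge0 => i _; rewrite mxE exprn_ge0 // mulr_ge0 // ltW.
have mB (u : 'rV[R]_n) m : (forall i, `|u 0 i| <= r) -> `|monomial u m| <= monomial w m.
  move=> ur; rewrite normr_prod; apply: ler_prod => i _.
  rewrite normr_ge0 /= normrX mxE lerXn2r ?nnegrE //.
    by rewrite mulr_ge0 // ltW.
  by apply: le_trans (ur i) _; lra.
have key (u v : 'rV[R]_n) (e : R) : 0 <= e -> (forall i, `|u 0 i| <= r) ->
    (forall i, `|v 0 i| <= r) -> (forall i, `|u 0 i - v 0 i| <= e) ->
    `|f (x + u)| <= B /\ `|f (x + u) - f (x + v)| <= B / r * e.
  move=> e0 ur vr uv.
  have cv (u' : 'rV[R]_n) : (forall i, `|u' 0 i| <= r) ->
      box_sum (fun m => a m * monomial u' m) @ \oo --> f (x + u').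
    by move=> u'r; apply: (Ha u' _).2 => i; apply: le_lt_trans (u'r i) _; rewrite /r; lra.
  have cu := cv u ur; have cv' := cv v vr; split.
    apply: cvg_norm_le cu _ => N; apply: le_trans (HB N); rewrite /box_sum.
    apply: le_trans (ler_norm_sum _ _ _) _; apply: ler_sum => m _.
    by rewrite !normrM ler_wpM2l // [leRHS]ger0_norm // mB.
  apply: cvg_norm_le (cvgB cu cv') _ => N; rewrite /box_sum /=.
  have <- : e / r * B = B / r * e by field; rewrite gt_eqF.
  rewrite -[X in `|X|]/(_ - _) -sumrB.
  apply: le_trans (ler_norm_sum _ _ _) _.
  have er : 0 <= e / r by rewrite divr_ge0 // ltW.
  apply: le_trans (ler_wpM2l er (HB N)); rewrite /box_sum mulr_sumr.
  apply: ler_sum => m _; rewrite -mulrBr !normrM mulrCA ler_wpM2l //.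
  by rewrite [X in _ * X]ger0_norm // ler_norm_monomialB.
exists (Num.min r (Num.min B^-1 (B / r)^-1)).
  by rewrite !lt_min r0 !invr_gt0 divr_gt0 // (lt_le_trans ltr01 B1).
move=> u v e e0 ur vr uv; set d := Num.min _ _ in ur vr *.
have d0 : 0 < d.
  by rewrite !lt_min r0 !invr_gt0 divr_gt0 // (lt_le_trans ltr01 B1).
have dr : d <= r by rewrite ge_min lexx.
have dB : B <= d^-1.
  rewrite -[B]invrK lef_pV2 ?posrE ?invr_gt0 ?(lt_le_trans ltr01 B1) //.
  by rewrite !ge_min lexx orbT.
have dBr : B / r <= d^-1.
  rewrite -[B / r]invrK lef_pV2 ?posrE ?invr_gt0 ?divr_gt0 ?(lt_le_trans ltr01 B1) //.
  by rewrite !ge_min lexx !orbT.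
have [h1 h2] := key u v e e0 (fun i => le_trans (ltW (ur i)) dr)
  (fun i => le_trans (ltW (vr i)) dr) uv.
by split; [exact: le_trans h1 dB | apply: le_trans h2 _; rewrite ler_wpM2r].
Qed.

(** Compactness of a box, for a property that holds for all small parameters
    locally uniformly.  Degenerate sides lo i = hi i are allowed; they serve to
    fix v1 = v2 = 0. *)
Lemma box_uniform (R : realType) (n : nat) (lo hi : 'I_n -> R)
    (Q : R -> 'rV[R]_n -> Prop) :
  (forall x : 'rV[R]_n, (forall i, lo i <= x 0 i <= hi i) ->
     exists2 e : R, 0 < e &
     forall (y : 'rV[R]_n) (d : R), (forall i, lo i <= y 0 i <= hi i) ->
       (forall i, `|y 0 i - x 0 i| < e) -> 0 < d < e -> Q d y) ->
  exists2 e : R, 0 < e &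
    forall x : 'rV[R]_n, (forall i, lo i <= x 0 i <= hi i) -> Q e x.
Proof.
move=> H; pose A : set 'rV[R]_n :=
  [set x : 'rV[R]_n | forall i, lo i <= x 0 i <= hi i].
have cA : compact A.
  have := @rV_compact R n (fun i => `[lo i, hi i]%classic)
    (fun i => @segment_compact R (lo i) (hi i)).
  by congr compact; apply/seteqP; split => x /= Ax i; have := Ax i; rewrite in_itv.
have := (compact_near_coveringP A).1 cA R (0^'+)
  (fun d y => A y -> Q d y) _ _.
move=> [|e /= e0 He].
  move=> x Ax; have [e e0 He] := H x Ax.
  exists (ball x e, [set d | 0 < d < e]) => [|[y d] [/= xy de] Ay].
    split; first exact: nbhsx_ballx.
    by near=> d; apply/andP; split; near: d;
      [exact: nbhs_right_gt | exact: nbhs_right_lt].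
  by apply: He => // i; rewrite distrC; case: xy => _ xy; exact: xy.
exists (e / 2); first by rewrite divr_gt0.
move=> x Ax; apply: (He (e / 2) _ _ x) => //.
- by rewrite /= sub0r normrN gtr0_norm ?divr_gt0 //; lra.
- by rewrite divr_gt0.
Unshelve. all: by end_near.
Qed.

Lemma analytic_lipschitz_box (R : realType) (n : nat) (f : 'rV[R]_n -> R)
    (lo hi : 'I_n -> R) :
  (forall x : 'rV[R]_n, (forall i, lo i <= x 0 i <= hi i) -> analytic_at f x) ->
  exists2 d : R, 0 < d &
    forall x : 'rV[R]_n, (forall i, lo i <= x 0 i <= hi i) -> lipschitz_near f d x.
Proof.
move=> Hf; apply: box_uniform => x /Hf /analytic_lipschitz_near[d d0 Hd].
exists (d / 2); first by rewrite divr_gt0.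
move=> y k _ yx /andP[k0 kd] u v e e0 uk vk uv.
have yE (w : 'rV[R]_n) : y + w = x + (y - x + w) by rewrite addrA [x + _]addrC subrK.
have sm (w : 'rV[R]_n) i : `|w 0 i| < k -> `|(y - x + w) 0 i| < d.
  move=> wk; rewrite !mxE; apply: le_lt_trans (ler_normD _ _) _.
  by have := yx i; rewrite ?mxE; lra.
rewrite (yE u) (yE v); have [|i|i|i|h1 h2] := Hd (y - x + u) (y - x + v) e => //.
- exact: sm.
- exact: sm.
- have -> : (y - x + u) 0 i - (y - x + v) 0 i = u 0 i - v 0 i by rewrite !mxE; ring.
  exact: uv.
have dk : d^-1 <= k^-1 by rewrite lef_pV2 ?posrE //; lra.
by split; [exact: le_trans dk | apply: le_trans h2 _; rewrite ler_wpM2r].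
Qed.

(** * The passage near the center manifold *)

Lemma is_derive_mul (R : realType) (t df dg : R) (f g : R -> R) :
  is_derive t (1 : R) f df -> is_derive t (1 : R) g dg ->
  is_derive t (1 : R) (fun s => f s * g s) (f t * dg + g t * df).
Proof. by move=> fdf gdg; have := is_deriveM fdf gdg. Qed.

Lemma is_derive_mull (R : realType) (k t df : R) (f : R -> R) :
  is_derive t (1 : R) f df -> is_derive t (1 : R) (fun s => k * f s) (k * df).
Proof. by move=> fdf; have := @is_deriveZ R R R f k t 1 df fdf. Qed.

Lemma MVT_is_derive (R : realType) (f df : R -> R) (T : R) :
  0 <= T -> (forall t, 0 <= t <= T -> is_derive t (1 : R) f (df t)) ->
  exists2 c, 0 <= c <= T & f T - f 0 = df c * T.
Proof.
move=> T0 fdf; have [||c] := @MVT_segment R f df 0 T T0.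
- move=> t /=; rewrite in_itv /= => /andP[t0 tT].
  by apply: fdf; rewrite !ltW.
- apply: derivable_within_continuous => t /=; rewrite in_itv /= => tT.
  by have [] := fdf t tT.
by rewrite in_itv /= subr0 => cT ->; exists c.
Qed.

Lemma is_derive_ge0_le (R : realType) (f df : R -> R) (T : R) :
  0 <= T -> (forall t, 0 <= t <= T -> is_derive t (1 : R) f (df t)) ->
  (forall t, 0 <= t <= T -> 0 <= df t) -> f 0 <= f T.
Proof.
move=> T0 /(MVT_is_derive T0)[c cT fE] /(_ c cT) dfc.
by rewrite -subr_ge0 fE mulr_ge0.
Qed.

Lemma is_derive_drift (R : realType) (f df : R -> R) (T k E : R) :
  0 <= T -> (forall t, 0 <= t <= T -> is_derive t (1 : R) f (df t)) ->
  (forall t, 0 <= t <= T -> `|df t - k| <= E) -> `|f T - f 0 - k * T| <= E * T.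
Proof.
move=> T0 /(MVT_is_derive T0)[c cT fE] /(_ c cT) dfc.
by rewrite fE -mulrBl normrM [`|T|]ger0_norm // ler_wpM2r.
Qed.

(** y ^+ 2 * exp (2 * B * t) is nondecreasing, so y never vanishes and keeps its
    sign; squaring avoids any reference to the sign of y before it is known. *)
Lemma linear_ode_gt0 (R : realType) (y g : R -> R) (T B : R) :
  0 <= T -> (forall t, 0 <= t <= T -> is_derive t (1 : R) y (y t * g t)) ->
  (forall t, 0 <= t <= T -> - B <= g t) -> 0 < y 0 -> 0 < y T.
Proof.
move=> T0 yg gB y0.
have sq t : 0 <= t <= T -> 0 < y t ^+ 2.
  move=> /andP[t0 tT].
  pose F s := y s * y s * expR (2 * B * s).
  pose dF s := 2 * (y s * y s) * (g s + B) * expR (2 * B * s).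
  have : F 0 <= F t.
    apply: (@is_derive_ge0_le R F dF) => // s /andP[s0 st].
      have dy := yg s; rewrite s0 (le_trans st tT) in dy; have {}dy := dy isT.
      have dL : is_derive s (1 : R) (fun s : R => 2 * B * s) (2 * B).
        by rewrite -[X in is_derive _ _ _ X]mulr1;
          exact: (is_derive_mull _ (is_derive_id _ _)).
      have dE : is_derive s (1 : R) (fun s : R => expR (2 * B * s))
          (expR (2 * B * s) * (2 * B)).
        exact: (is_derive1_comp (is_derive_expR _) dL).
      have := is_derive_mul (is_derive_mul dy dy) dE; congr (is_derive _ _ _ _).
      by rewrite /dF; ring.
    have gBs : 0 <= g s + B.
      by have := gB s; rewrite s0 (le_trans st tT) => /(_ isT); lra.
    rewrite /dF -expr2; apply/mulr_ge0/expR_ge0.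
    by apply: mulr_ge0 gBs; apply: mulr_ge0 => //; exact: sqr_ge0.
  rewrite /F mulr0 expR0 mulr1 -!expr2 => Ft.
  have e0 := expR_gt0 (2 * B * t).
  by rewrite -(pmulr_lgt0 _ e0); apply: lt_le_trans Ft; rewrite exprn_gt0.
rewrite ltNge; apply/negP => yT.
have [||c] := @IVT R y 0 T 0 T0.
- apply: derivable_within_continuous => t /=; rewrite in_itv /= => tT.
  by have [] := yg t tT.
- by rewrite ge_min yT orbT le_max ltW.
by rewrite in_itv /= => /sq; rewrite lt0r => /andP[+ _] => /[swap] ->;
  rewrite expr0n eqxx.
Qed.

(** What the passage estimates use of the system: one constant B bounds sizes,
    Lipschitz constants and inverse rates, on the neighbourhood of D of size d.
    The last field bounds the logarithmic derivatives of v1, of v2 and of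
    v1 * v2. *)
Record local_bounds (R : realType) (S : coefs R) (B d : R) : Prop :=
  LocalBounds {
  lb_B : 1 <= B;
  lb_d : 0 < d;
  lb_lip : forall b r : R, 0 <= b <= 1 -> `|r - b| <= d ->
    [/\ `|p S r - p S b| <= B * `|r - b|, `|sg S r - sg S b| <= B * `|r - b|
      & `|omega S r - omega S b| <= B * `|r - b|];
  lb_size : forall b : R, 0 <= b <= 1 ->
    [/\ `|p S b| <= B, `|sg S b| <= B, `|omega S b| <= B & B^-1 <= p S b];
  lb_nonlinear : forall x, near_D d x ->
    [/\ `|p0 S x| <= B, `|sg0 S x| <= B, `|r0 S x| <= B & `|omega0 S x| <= B];
  lb_rates : forall x, near_D d x -> let u := x 0 0 * x 0 1 in
    [/\ B^-1 <= p S (x 0 2) + p0 S x * u, - B <= sg S (x 0 2) + sg0 S x * u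
      & p S (x 0 2) + sg S (x 0 2) + (p0 S x + sg0 S x) * u <= - B^-1] }.

(** With u = v1 * v2, the rate bounds give u <= - B * u', hence
    |r'| <= B * u <= - B ^ 2 * u', so that r + B ^ 2 * u is nonincreasing and
    r - B ^ 2 * u nondecreasing.  This confines r within B ^ 2 * u(0) of its
    initial value for an arbitrarily long time T.  D is the resulting distance of
    r to the reference radius b, and E the resulting error in the rates of
    ln v1, ln v2 and phi. *)
Lemma trajectory_estimates (R : realType) (S : coefs R) (B d h T V rho phi b : R)
    (x : R -> 'rV[R]_4) :
  local_bounds S B d -> 0 < h <= d -> 0 <= T -> trajectory S T x ->
  (forall t : R, 0 <= t <= T -> near_D h (x t)) ->
  x 0 = pt4 V h rho phi -> 0 < V -> 0 <= b <= 1 ->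
  let D : R := `|rho - b| + B ^+ 2 * (V * h) in
  let E : R := B * D + B * (V * h) in
  D <= d ->
  [/\ 0 < x T 0 1, `|x T 0 2 - b| <= D & T <= B * (ln (x T 0 0) - ln V)] /\
  [/\ `|ln (x T 0 0) - ln V - p S b * T| <= E * T,
      `|ln (x T 0 1) - ln h - sg S b * T| <= E * T
    & `|x T 0 3 - phi - omega S b * T| <= E * T].
Proof.
move=> lb /andP[h0 hd] T0 traj nearh x0 V0 b01 D E Dd.
have B1 := lb_B lb; have B0 : 0 < B by lra.
have near t : 0 <= t <= T -> near_D d (x t).
  by move=> /nearh[a1 a2 /andP[a3 a4]]; split; [lra|lra|apply/andP; split; lra].
pose v1 t : R := x t 0 0; pose v2 t : R := x t 0 1; pose r t : R := x t 0 2.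
pose ph t : R := x t 0 3; pose u t := v1 t * v2 t.
have v10 : v1 0 = V by rewrite /v1 x0 mxE.
have v20 : v2 0 = h by rewrite /v2 x0 mxE.
have r00 : r 0 = rho by rewrite /r x0 mxE.
have ph0 : ph 0 = phi by rewrite /ph x0 mxE.
pose g1 t := p S (r t) + p0 S (x t) * u t.
pose g2 t := sg S (r t) + sg0 S (x t) * u t.
have dv1 t : 0 <= t <= T -> is_derive t (1 : R) v1 (v1 t * g1 t).
  move=> tT; have := traj t tT 0; congr (is_derive _ _ _ _).
  by rewrite mxE /= /g1 /u /v1 /v2 /r; ring.
have dv2 t : 0 <= t <= T -> is_derive t (1 : R) v2 (v2 t * g2 t).
  move=> tT; have := traj t tT 1; congr (is_derive _ _ _ _).
  by rewrite mxE /= /g2 /u /v1 /v2 /r; ring.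
have dr t : 0 <= t <= T -> is_derive t (1 : R) r (u t * r0 S (x t)).
  move=> tT; have := traj t tT 2; congr (is_derive _ _ _ _).
  by rewrite mxE.
have dph t : 0 <= t <= T ->
    is_derive t (1 : R) ph (omega S (r t) + u t * omega0 S (x t)).
  move=> tT; have := traj t tT 3; congr (is_derive _ _ _ _).
  by rewrite mxE.
have sub t : 0 <= t <= T -> forall s, 0 <= s <= t -> 0 <= s <= T.
  by move=> /andP[t0 tT] s /andP[s0 st]; rewrite s0 (le_trans st tT).
have v1_gt0 t : 0 <= t <= T -> 0 < v1 t.
  move=> tT; apply: (@linear_ode_gt0 R v1 g1 t B); rewrite ?v10 //.
  - by case/andP: tT.
  - by move=> s /(sub t tT); exact: dv1.
  move=> s /(sub t tT) /near /(lb_rates lb)[] /= + _ _.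
  have : 0 < B^-1 by rewrite invr_gt0.
  by rewrite /g1 /u /v1 /v2 /r; lra.
have v2_gt0 t : 0 <= t <= T -> 0 < v2 t.
  move=> tT; apply: (@linear_ode_gt0 R v2 g2 t B); rewrite ?v20 //.
  - by case/andP: tT.
  - by move=> s /(sub t tT); exact: dv2.
  by move=> s /(sub t tT) /near /(lb_rates lb)[].
have u_gt0 t : 0 <= t <= T -> 0 < u t.
  by move=> tT; rewrite /u mulr_gt0 ?v1_gt0 ?v2_gt0.
pose du t := u t * (g1 t + g2 t).
have dU t : 0 <= t <= T -> is_derive t (1 : R) u (du t).
  move=> tT; have := is_derive_mul (dv1 t tT) (dv2 t tT); congr (is_derive _ _ _ _).
  by rewrite /du /u; ring.
(* decay of u in the form in which it is integrated below *)
have duB t : 0 <= t <= T -> u t <= - (B * du t).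
  move=> tT; have [_ _ /=] := lb_rates lb (near t tT).
  rewrite -/(v1 t) -/(v2 t) -/(r t) -/(u t) => H.
  have : g1 t + g2 t <= - B^-1 by rewrite /g1 /g2; lra.
  have Bu : B * u t * - B^-1 = - u t by field; rewrite gt_eqF.
  rewrite -(ler_pM2l (mulr_gt0 B0 (u_gt0 t tT))) Bu /du; lra.
have u_le t : 0 <= t <= T -> u t <= V * h.
  move=> tT; rewrite -v10 -v20 -/(u 0) -lerN2.
  apply: (@is_derive_ge0_le R (fun s => - u s) (fun s => - du s)).
  - by case/andP: tT.
  - by move=> s /(sub t tT) sT; apply: is_deriveN; exact: dU.
  move=> s /(sub t tT) sT; have := duB s sT; have := u_gt0 s sT.
  rewrite -mulrN => us Hs; rewrite -(pmulr_rge0 _ B0).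
  by apply: le_trans Hs; exact: ltW.
(* the two signs k = 1, -1 give the two sides of the bound on r *)
have r_le (k : R) t : 0 <= t <= T -> `|k| = 1 -> k * (r t - rho) <= B ^+ 2 * (V * h).
  move=> tT k1.
  have : - k * r 0 - B ^+ 2 * u 0 <= - k * r t - B ^+ 2 * u t.
    apply: (@is_derive_ge0_le R (fun s => - k * r s - B ^+ 2 * u s)
      (fun s => - k * (u s * r0 S (x s)) - B ^+ 2 * du s)).
    - by case/andP: tT.
    - move=> s /(sub t tT) sT; apply: is_deriveB.
        by apply: is_derive_mull; exact: dr.
      by apply: is_derive_mull; exact: dU.
    move=> s /(sub t tT) sT; have [_ _ rB _] := lb_nonlinear lb (near s sT).
    have us := u_gt0 s sT; have H := duB s sT.
    have : k * (u s * r0 S (x s)) <= u s * B.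
      apply: le_trans (ler_norm _) _; rewrite normrM k1 mul1r normrM (gtr0_norm us).
      by apply: ler_wpM2l => //; exact: ltW.
    have : u s * B <= - (B * du s) * B by rewrite ler_wpM2r // ltW.
    by rewrite expr2; lra.
  rewrite r00 {1}/u v10 v20; have : 0 <= B ^+ 2 * u t.
    by rewrite mulr_ge0 ?sqr_ge0 // ltW // u_gt0.
  by lra.
have rD t : 0 <= t <= T -> `|r t - b| <= D.
  move=> tT; rewrite -[r t - b](subrKA rho).
  apply: le_trans (ler_normD _ _) _; rewrite addrC lerD2l ler_norml.
  have := r_le 1 t tT (normr1 _); have := r_le (-1) t tT; rewrite normrN1 => /(_ erefl).
  by move=> h1 h2; apply/andP; split; lra.
have lip t : 0 <= t <= T -> [/\ `|p S (r t) - p S b| <= B * D,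
    `|sg S (r t) - sg S b| <= B * D & `|omega S (r t) - omega S b| <= B * D].
  move=> tT; have rd := rD t tT.
  have [q1 q2 q3] := lb_lip lb b01 (le_trans rd Dd).
  have : B * `|r t - b| <= B * D by rewrite ler_wpM2l // ltW.
  by split; lra.
have nl t f : 0 <= t <= T -> `|f| <= B -> `|f * u t| <= B * (V * h).
  move=> tT fB; rewrite normrM ler_pM //.
  by rewrite gtr0_norm ?u_gt0 // u_le.
have TT : 0 <= T <= T by rewrite T0 lexx.
have dln (y g : R -> R) : (forall t, 0 <= t <= T -> is_derive t (1 : R) y (y t * g t)) ->
    (forall t, 0 <= t <= T -> 0 < y t) ->
    forall t, 0 <= t <= T -> is_derive t (1 : R) (fun s => ln (y s)) (g t).
  move=> dy y0 t tT; have := is_derive1_comp (is_derive1_ln (y0 t tT)) (dy t tT).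
  congr (is_derive _ _ _ _).
  by rewrite mulrA mulVf ?mul1r // gt_eqF // y0.
have dl1 := dln v1 g1 dv1 v1_gt0; have dl2 := dln v2 g2 dv2 v2_gt0.
have close (a c fb : R) : `|a - fb| <= B * D -> `|c| <= B * (V * h) -> `|a + c - fb| <= E.
  move=> h1 h2; have -> : a + c - fb = (a - fb) + c by ring.
  by apply: le_trans (ler_normD _ _) _; rewrite /E lerD.
split; split.
- exact: v2_gt0.
- exact: rD.
- have [c cT] := MVT_is_derive T0 dl1; rewrite v10 => ->.
  have [/= H _ _] := lb_rates lb (near c cT).
  rewrite mulrA ler_peMl //.
  have <- : B * B^-1 = 1 by rewrite mulfV ?gt_eqF.
  by rewrite ler_wpM2l // ltW.
- rewrite -/(v1 T) -v10; apply: (is_derive_drift T0 dl1) => t tT.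
  have [l1 _ _] := lip t tT; have [n1 _ _ _] := lb_nonlinear lb (near t tT).
  by apply: close => //; exact: nl.
- rewrite -/(v2 T) -v20; apply: (is_derive_drift T0 dl2) => t tT.
  have [_ l1 _] := lip t tT; have [_ n1 _ _] := lb_nonlinear lb (near t tT).
  by apply: close => //; exact: nl.
- rewrite -/(ph T) -ph0; apply: (is_derive_drift T0 dph) => t tT.
  have [_ _ l1] := lip t tT; have [_ _ _ n1] := lb_nonlinear lb (near t tT).
  by apply: close => //; rewrite mulrC; exact: nl.
Qed.

(** * Uniform bounds for the normal form *)

Lemma int_translate (R : realType) (P : R -> Prop) :
  (forall t, P t <-> P (t + 1)) -> forall (k : int) t, P t <-> P (t + k%:~R).
Proof.
move=> P1 k t; elim: k => [|n IH|n IH]; first by rewrite addr0.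
- by rewrite -addn1 PoszD intrD addrA -P1.
- rewrite IH; have := P1 (t + (- n.+1%:Z)%:~R).
  suff -> : t + (- n.+1%:Z)%:~R + 1 = t + (- n%:Z)%:~R by move=> ->.
  by rewrite !intrN intS intrD; ring.
Qed.

Lemma exists_mod1 (R : realType) (t : R) : exists k : int, 0 <= t + k%:~R <= 1.
Proof.
exists (- Num.floor t); rewrite intrN.
have := floor_itv t; rewrite intrD => /andP[h1 h2].
by apply/andP; split; lra.
Qed.

Lemma box_lower_bound (R : realType) (n : nat) (lo hi : 'I_n -> R)
    (f : 'rV[R]_n -> R) :
  (forall x : 'rV[R]_n, (forall i, lo i <= x 0 i <= hi i) ->
     exists2 e : R, 0 < e &
     forall y : 'rV[R]_n, (forall i, lo i <= y 0 i <= hi i) ->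
       (forall i, `|y 0 i - x 0 i| < e) -> e <= f y) ->
  exists2 m : R, 0 < m &
    forall x : 'rV[R]_n, (forall i, lo i <= x 0 i <= hi i) -> m <= f x.
Proof.
move=> H; apply: box_uniform => x /H[e e0 He]; exists e => // y d yb yx.
by move=> /andP[_ /ltW de]; apply: le_trans de _; exact: He.
Qed.

Lemma analytic1_lipschitz (R : realType) (f : R -> R) :
  (forall r, 0 <= r <= 1 -> analytic1_at f r) ->
  exists2 d : R, 0 < d & forall b r : R, 0 <= b <= 1 -> `|r - b| < d ->
    `|f r| <= d^-1 /\ `|f r - f b| <= d^-1 * `|r - b|.
Proof.
move=> fA; have [|d d0 Hd] := @analytic_lipschitz_box R 1
    (fun u => f (u 0 0)) (fun=> 0) (fun=> 1).
  move=> x xb; have -> : x = pt1 (x 0 0).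
    by apply/rowP => i; rewrite !mxE ord1.
  exact/fA/xb.
exists d => // b r b01 rb.
have [|||||] := Hd (pt1 b) _ (pt1 (r - b)) (pt1 0) `|r - b|.
- by move=> i; rewrite mxE.
- by [].
- by move=> i; rewrite mxE.
- by move=> i; rewrite mxE normr0.
- by move=> i; rewrite !mxE subr0.
by rewrite !mxE addrC subrK addr0.
Qed.

Lemma lipschitz_lower_bound (R : realType) (f : R -> R) (d : R) :
  0 < d -> (forall b r : R, 0 <= b <= 1 -> `|r - b| < d ->
    `|f r - f b| <= d^-1 * `|r - b|) ->
  (forall b, 0 <= b <= 1 -> 0 < f b) ->
  exists2 m : R, 0 < m & forall b, 0 <= b <= 1 -> m <= f b.
Proof.
move=> d0 fL f0.
have [|m m0 Hm] := @box_lower_bound R 1 (fun=> 0) (fun=> 1) (fun u => f (u 0 0)).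
  move=> x xb; have fx := f0 _ (xb 0); set b := x 0 0 in fx *.
  have c0 : 0 < Num.min d (d * (f b / 2)) by rewrite lt_min d0 !mulr_gt0.
  exists (Num.min (Num.min d (d * (f b / 2))) (f b / 2)).
    by rewrite lt_min c0 divr_gt0.
  move=> y yb /(_ 0); rewrite !lt_min => /andP[/andP[yd yf] _].
  have := fL b (y 0 0) (xb 0) yd.
  have : d^-1 * `|y 0 0 - b| <= f b / 2 by rewrite mulrC ler_pdivrMr // mulrC ltW.
  rewrite ge_min => h1 h2; apply/orP; right.
  by have := le_trans h2 h1; rewrite ler_norml => /andP[]; lra.
exists m => // b b01; have := Hm (pt1 b); rewrite mxE; apply => i.
by rewrite mxE.
Qed.

Lemma dist_itv01 (R : realType) (d r : R) :
  0 <= d -> - d <= r <= 1 + d -> exists2 b, 0 <= b <= 1 & `|r - b| <= d.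
Proof.
move=> d0 /andP[r1 r2]; have [r0|r0] := leP 0 r.
  have [r3|r3] := leP r 1; first by exists r; rewrite ?r0 // subrr normr0; lra.
  by exists 1; rewrite ?ler01 ?lexx // ger0_norm; lra.
by exists 0; rewrite ?ler01 ?lexx // subr0 ltr0_norm //; lra.
Qed.

(** Periodicity brings phi to [0, 1]; then x differs by a small vector from a
    point of D with r and phi in [0, 1]. *)
Lemma analytic_on_D_bounded (R : realType) (f : 'rV[R]_4 -> R) :
  analytic_on_D f -> periodic_in_phi f ->
  exists2 d : R, 0 < d & forall (c : R) x, c < d -> near_D c x -> `|f x| <= d^-1.
Proof.
move=> fA fP; pose hi (i : 'I_4) : R := if (2 <= i)%N then 1 else 0.
have [|d d0 Hd] := @analytic_lipschitz_box R 4 f (fun=> 0) hi.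
  move=> x xb; have -> : x = pt4 0 0 (x 0 2) (x 0 3).
    apply/rowP => i; rewrite mxE.
    case: i => -[|[|[|[|]]]] //= i4.
    - by have := xb (Ordinal i4); rewrite /hi /= => /le_anti.
    - by have := xb (Ordinal i4); rewrite /hi /= => /le_anti.
    - by congr (x _ _); apply: val_inj.
    - by congr (x _ _); apply: val_inj.
  exact/fA/(xb 2).
exists d => // c x cd [x0 x1 x2].
have [b b01 rb] := dist_itv01 (le_trans (normr_ge0 _) x0) x2.
have [k kphi] := exists_mod1 (x 0 3).
have -> : f x = f (pt4 (x 0 0) (x 0 1) (x 0 2) (x 0 3 + k%:~R)).
  have := @int_translate R (fun t => f x = f (pt4 (x 0 0) (x 0 1) (x 0 2) t)) _ k (x 0 3).
  move=> H; apply/H => [t|]; first by rewrite fP.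
  congr f; apply/rowP => i; rewrite mxE.
  by case: i => -[|[|[|[|]]]] //= i4; congr (x _ _); apply: val_inj.
set phi := x 0 3 + _ in kphi *.
pose u : 'rV[R]_4 := pt4 (x 0 0) (x 0 1) (x 0 2 - b) 0.
have ud (i : 'I_4) : `|u 0 i| < d.
  rewrite mxE; case: i => -[|[|[|[|]]]] //= i4; rewrite ?normr0 //; lra.
have [|||||H _] := Hd (pt4 0 0 b phi) _ u u 0 => //.
- by move=> i; rewrite mxE /hi; case: i => -[|[|[|[|]]]] //= i4; rewrite lexx.
- by move=> i; rewrite subrr normr0.
suff -> : pt4 (x 0 0) (x 0 1) (x 0 2) phi = pt4 0 0 b phi + u by [].
apply/rowP => i; rewrite !mxE.
by case: i => -[|[|[|[|]]]] //= i4; rewrite ?add0r ?addr0 // addrC subrK.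
Qed.

(** Within distance d of D the coefficients p and p + varsigma move by at most a
    multiple of L * d, and the nonlinear terms are at most L * d because
    |v1 * v2| <= d ^ 2 <= d.  Taking L * d small against the least value m of p
    and of - (p + varsigma) on [0, 1] keeps all rates bounded away from 0. *)
Lemma normal_form_local_bounds (R : realType) (S : coefs R) :
  normal_form S -> exists B d : R, local_bounds S B d.
Proof.
move=> nf; have [A0 A1 A2 A3] := nf_analytic4 nf; have [P0 P1 P2 P3] := nf_periodic nf.
have [|dp dp0 Hp] := @analytic1_lipschitz R (p S).
  by move=> r /(nf_analytic1 nf)[].
have [|ds ds0 Hs] := @analytic1_lipschitz R (sg S).
  by move=> r /(nf_analytic1 nf)[].
have [|dw dw0 Hw] := @analytic1_lipschitz R (omega S).
  by move=> r /(nf_analytic1 nf)[].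
have [d1 d10 H1] := analytic_on_D_bounded A0 P0.
have [d2 d20 H2] := analytic_on_D_bounded A1 P1.
have [d3 d30 H3] := analytic_on_D_bounded A2 P2.
have [d4 d40 H4] := analytic_on_D_bounded A3 P3.
pose d0 : R := Num.min (Num.min (Num.min dp ds) (Num.min dw 1))
  (Num.min (Num.min d1 d2) (Num.min d3 d4)).
have d00 : 0 < d0 by rewrite !lt_min dp0 ds0 dw0 d10 d20 d30 d40 ltr01.
have dle : [/\ d0 <= dp, d0 <= ds, d0 <= dw & d0 <= 1] /\
    [/\ d0 <= d1, d0 <= d2, d0 <= d3 & d0 <= d4].
  by split; split; rewrite !ge_min lexx ?orbT.
case: dle => -[dlp dls dlw dl_1] [dl1 dl2 dl3 dl4].
pose L : R := d0^-1; have L1 : 1 <= L by rewrite invf_ge1.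
have Lge (d : R) : 0 < d -> d0 <= d -> d^-1 <= L by move=> *; rewrite lef_pV2.
have lip (f : R -> R) (d : R) : 0 < d -> d0 <= d ->
    (forall b r : R, 0 <= b <= 1 -> `|r - b| < d ->
      `|f r| <= d^-1 /\ `|f r - f b| <= d^-1 * `|r - b|) ->
    forall b r : R, 0 <= b <= 1 -> `|r - b| < d0 ->
      `|f r| <= L /\ `|f r - f b| <= L * `|r - b|.
  move=> dd dle Hf b r b01 rb; have [h1 h2] := Hf b r b01 (lt_le_trans rb dle).
  split; first exact: le_trans h1 (Lge d dd dle).
  by apply: le_trans h2 _; rewrite ler_wpM2r // Lge.
have {Hp} Hp := lip _ _ dp0 dlp Hp.
have {Hs} Hs := lip _ _ ds0 dls Hs.
have {Hw} Hw := lip _ _ dw0 dlw Hw.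
have [|b b01|m1 m10 Hm1] := @lipschitz_lower_bound R (p S) d0 d00.
- by move=> b r b01 rb; have [] := Hp b r b01 rb.
- by have [] := nf_signs nf b01.
have [|b b01|m2 m20 Hm2] := @lipschitz_lower_bound R
    (fun r => - (p S r + sg S r)) (d0 / 2) (divr_gt0 d00 (ltr0Sn R 1)).
- move=> b r b01 rb; have rb' : `|r - b| < d0 by lra.
  have [_ h1] := Hp b r b01 rb'; have [_ h2] := Hs b r b01 rb'.
  have -> : - (p S r + sg S r) - - (p S b + sg S b)
    = - (p S r - p S b) + - (sg S r - sg S b) by ring.
  apply: le_trans (ler_normD _ _) _; rewrite !normrN invf_div.
  have -> : 2 / d0 = L + L by rewrite /L; field; rewrite gt_eqF.
  by rewrite mulrDl lerD.
- by have [] := nf_signs nf b01; lra.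
pose m : R := Num.min m1 m2.
have m0 : 0 < m by rewrite lt_min m10.
have mm : m <= m1 /\ m <= m2 by rewrite !ge_min !lexx orbT.
pose d : R := Num.min (d0 / 2) (m / (8 * L)).
have dd0 : 0 < d by rewrite lt_min !divr_gt0 //; lra.
have ddd0 : d <= d0 / 2 by rewrite ge_min lexx.
have Ld : L * d <= m / 8.
  have : d <= m / (8 * L) by rewrite ge_min lexx orbT.
  rewrite -(ler_pM2l (_ : 0 < L)); last by lra.
  by have -> : L * (m / (8 * L)) = m / 8 by field; rewrite gt_eqF //; lra.
pose B := 3 * L + 2 / m.
have m20' : 0 < 2 / m by rewrite divr_gt0.
have LB : L <= B by rewrite /B; lra.
have Bm : B^-1 <= m / 2.
  by rewrite -[m / 2]invf_div lef_pV2 ?posrE // /B; lra.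
have NL x : near_D d x ->
    [/\ `|p0 S x| <= L, `|sg0 S x| <= L, `|r0 S x| <= L & `|omega0 S x| <= L].
  move=> xd; split.
  - by apply: le_trans (H1 d x _ xd) (Lge d1 _ _) => //; lra.
  - by apply: le_trans (H2 d x _ xd) (Lge d2 _ _) => //; lra.
  - by apply: le_trans (H3 d x _ xd) (Lge d3 _ _) => //; lra.
  - by apply: le_trans (H4 d x _ xd) (Lge d4 _ _) => //; lra.
exists B, d; split => //.
- by rewrite /B; lra.
- move=> b r b01 rb; have rb' : `|r - b| < d0 by lra.
  have LBr : L * `|r - b| <= B * `|r - b| by rewrite ler_wpM2r.
  have [_ h1] := Hp b r b01 rb'; have [_ h2] := Hs b r b01 rb'.
  by have [_ h3] := Hw b r b01 rb'; split; exact: le_trans LBr.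
- move=> b b01; have bb : `|b - b| < d0 by rewrite subrr normr0.
  have [h1 _] := Hp b b b01 bb; have [h2 _] := Hs b b b01 bb.
  have [h3 _] := Hw b b b01 bb; have pm := Hm1 b b01.
  split; [exact: le_trans LB | exact: le_trans LB | exact: le_trans LB |].
  by apply: le_trans Bm _; lra.
- by move=> x /NL[h1 h2 h3 h4]; split; exact: le_trans LB.
move=> x xd u; have [h1 h2 _ _] := NL x xd.
case: xd => x0 x1 /(dist_itv01 (ltW dd0))[b b01 rb].
have rb' : `|x 0 2 - b| < d0 by lra.
have [h3 h3'] := Hp b _ b01 rb'; have [h4 h4'] := Hs b _ b01 rb'.
have Lr : L * `|x 0 2 - b| <= L * d by rewrite ler_wpM2l //; lra.
have ud : `|u| <= d.
  rewrite normrM -[d]mulr1 ler_pM //; lra.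
have pu (f : R) : `|f| <= L -> `|f * u| <= L * d by move=> fL; rewrite normrM ler_pM.
have := pu _ h1; have := pu _ h2; have := Hm1 b b01; have := Hm2 b b01.
have := le_trans h3' Lr; have := le_trans h4' Lr; case: mm.
move: h3 h4; rewrite !ler_norml /B.
move=> /andP[a1 a2] /andP[a3 a4] mm1 mm2 /andP[a5 a6] /andP[a7 a8] a9 a10.
by move=> /andP[a11 a12] /andP[a13 a14]; split; lra.
Qed.

(** * Uniform bounds for the global map *)

(** Only the base point has to lie in the box, so (r', phi') may leave it. *)
Lemma analytic3_lipschitz (R : realType) (f : 'rV[R]_3 -> R) :
  (forall r phi, 0 <= r <= 1 -> analytic_at f (pt3 0 r phi)) ->
  exists2 d : R, 0 < d &
    forall r phi v w r' phi' e : R, 0 <= r <= 1 -> 0 <= phi <= 1 ->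
    `|v| < d -> `|w| < d -> `|r' - r| < d -> `|phi' - phi| < d ->
    `|w - v| <= e -> `|r' - r| <= e -> `|phi' - phi| <= e ->
    `|f (pt3 v r phi)| <= d^-1 /\
    `|f (pt3 v r phi) - f (pt3 w r' phi')| <= d^-1 * e.
Proof.
move=> fA; pose hi (i : 'I_3) : R := if (1 <= i)%N then 1 else 0.
have [|d d0 Hd] := @analytic_lipschitz_box R 3 f (fun=> 0) hi.
  move=> x xb; have -> : x = pt3 0 (x 0 1) (x 0 2).
    apply/rowP => i; rewrite mxE.
    case: i => -[|[|[|]]] //= i3.
    - by have := xb (Ordinal i3); rewrite /hi /= => /le_anti.
    - by congr (x _ _); apply: val_inj.
    - by congr (x _ _); apply: val_inj.
  exact/fA/(xb 1).
exists d => // r phi v w r' phi' e r01 phi01 vd wd rd phid wv rr pp.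
have e0 : 0 <= e := le_trans (normr_ge0 _) rr.
have E (s t y : R) : pt3 s (r + t) (phi + y) = pt3 0 r phi + pt3 s t y.
  apply/rowP => i; rewrite !mxE.
  by case: i => -[|[|[|]]] //= i3; rewrite add0r.
have -> : pt3 v r phi = pt3 0 r phi + pt3 v 0 0 by rewrite -E !addr0.
have -> : pt3 w r' phi' = pt3 0 r phi + pt3 w (r' - r) (phi' - phi).
  by rewrite -E [r + _]addrC [phi + _]addrC !subrK.
apply: Hd => // i; rewrite !mxE /hi; case: i => -[|[|[|]]] //= i3.
- by rewrite lexx.
- by rewrite normr0.
- by rewrite normr0.
- by rewrite distrC.
- by rewrite sub0r normrN.
- by rewrite sub0r normrN.
Qed.

(** The regularity of a1 has to be extracted from that of f.  For a fixed small v
    the quotient f (v, r, phi) / v is Lipschitz in (r, phi) and within K * v of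
    a1; taking v small against the value of a1 at the base point bounds a1 from
    below nearby.  The upper bound comes from the same comparison at one v. *)
Lemma a1_two_sided_bound (R : realType) (f : 'rV[R]_3 -> R) (a1 : R -> R -> R)
    (K d : R) :
  (forall r phi, 0 <= r <= 1 -> analytic_at f (pt3 0 r phi)) -> 0 < d ->
  (forall v r phi : R, `|v| < d -> 0 <= r <= 1 ->
    `|f (pt3 v r phi) - a1 r phi * v| <= K * v ^+ 2) ->
  (forall r phi, 0 <= r <= 1 -> 0 < a1 r phi) ->
  exists2 m : R, 0 < m &
    forall r phi, 0 <= r <= 1 -> 0 <= phi <= 1 -> m <= a1 r phi <= m^-1.
Proof.
move=> fA d_gt0 fK a1_gt0.
have [c c0 fL] := analytic3_lipschitz fA.
pose hi (i : 'I_3) : R := if (1 <= i)%N then 1 else 0.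
have K0 : 0 <= `|K| := normr_ge0 K; have KK := ler_norm K.
have [|m m0 Hm] := @box_lower_bound R 3 (fun=> 0) hi (fun x => a1 (x 0 1) (x 0 2)).
  move=> x xb; have r01 := xb 1; have p01 := xb 2; rewrite /hi /= in r01 p01.
  set r := x 0 1 in r01 *; set phi := x 0 2 in p01 *.
  have a0 := a1_gt0 r phi r01; set a := a1 r phi in a0.
  pose v := Num.min (Num.min (d / 2) (c / 2)) (a / (4 * (`|K| + 1))).
  have v0 : 0 < v by rewrite !lt_min !divr_gt0 //; lra.
  have vd : `|v| < d.
    rewrite gtr0_norm // !gt_min; apply/orP; left; apply/orP; left; lra.
  have vc : `|v| < c.
    rewrite gtr0_norm // !gt_min; apply/orP; left; apply/orP; right; lra.
  have Kv : K * v ^+ 2 <= a * v / 4.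
    have : v <= a / (4 * (`|K| + 1)) by rewrite ge_min lexx orbT.
    rewrite ler_pdivlMr; last lra.
    move=> H; have : (`|K| + 1) * v <= a / 4 by lra.
    have : K * v <= (`|K| + 1) * v by rewrite ler_wpM2r //; lra.
    move=> h1 h2; have := ler_wpM2r (ltW v0) (le_trans h1 h2).
    by rewrite expr2; lra.
  have av0 : 0 < a * v by rewrite mulr_gt0.
  exists (Num.min (Num.min c (a / 4)) (c * (a * v / 8))).
    by rewrite !lt_min c0 !mulr_gt0 //; lra.
  move=> y yb yx; have yr01 := yb 1; rewrite /hi /= in yr01.
  set e := Num.min _ _ in yx *.
  have ec : e <= c by rewrite !ge_min lexx.
  have ea : e <= a / 4 by rewrite !ge_min lexx orbT.
  have ev : e <= c * (a * v / 8) by rewrite !ge_min lexx orbT.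
  have e0 : 0 < e by apply: le_lt_trans (yx 1).
  have [|||||||_] := fL r phi v v (y 0 1) (y 0 2) e r01 p01.
  - by [].
  - by [].
  - exact: lt_le_trans (yx 1) ec.
  - exact: lt_le_trans (yx 2) ec.
  - by rewrite subrr normr0 ltW.
  - exact: ltW (yx 1).
  - exact: ltW (yx 2).
  have : c^-1 * e <= a * v / 8 by rewrite mulrC ler_pdivrMr // mulrC.
  have := fK v r phi vd r01; have := fK v (y 0 1) (y 0 2) vd yr01.
  rewrite -/a !ler_norml => /andP[h1 h2] /andP[h3 h4] h5 /andP[h6 h7].
  rewrite -(ler_pM2r v0).
  have : e * v <= a / 4 * v by rewrite ler_wpM2r // ltW.
  by lra.
pose v := Num.min (d / 2) (c / 2).
have v0 : 0 < v by rewrite lt_min !divr_gt0.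
have vd : `|v| < d by rewrite gtr0_norm // gt_min; apply/orP; left; lra.
have vc : `|v| < c by rewrite gtr0_norm // gt_min; apply/orP; right; lra.
pose M := (c^-1 + `|K| * v ^+ 2) / v.
have M0 : 0 < M.
  by rewrite divr_gt0 // ltr_pwDl ?invr_gt0 // mulr_ge0 // sqr_ge0.
exists (Num.min m M^-1); first by rewrite lt_min m0 invr_gt0.
move=> r phi r01 p01; apply/andP; split.
  rewrite ge_min; apply/orP; left.
  have := Hm (pt3 0 r phi); rewrite !mxE; apply => i.
  by rewrite mxE /hi; case: i => -[|[|[|]]] //= i3; rewrite lexx.
apply: (@le_trans _ _ M); last first.
  by rewrite -[leLHS]invrK lef_pV2 ?posrE ?lt_min ?m0 ?invr_gt0 // ge_min lexx orbT.
rewrite /M ler_pdivlMr //.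
have [|||||||+ _] := fL r phi v v r phi 0 r01 p01.
- by [].
- by [].
- by rewrite subrr normr0.
- by rewrite subrr normr0.
- by rewrite subrr normr0.
- by rewrite subrr normr0.
- by rewrite subrr normr0.
have := fK v r phi vd r01.
have : K * v ^+ 2 <= `|K| * v ^+ 2 by rewrite ler_wpM2r ?sqr_ge0.
by rewrite !ler_norml => ? /andP[? ?] /andP[? ?]; lra.
Qed.

(** At v = 0 the expansion says that b0 and c0 are the values of the second and
    third components of glob, so the Lipschitz bounds of these components are
    enough.  All four claims are invariant under phi -> phi + 1, the last one
    thanks to its integer, which reduces them to phi in [0, 1]. *)
Lemma global_map_bounds (R : realType) (glob : 'rV[R]_3 -> 'rV[R]_3)
    (a1 b0 b1 c0 c1 : R -> R -> R) :
  global_map glob a1 b0 b1 c0 c1 ->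
  exists B d : R, [/\ 1 <= B, 0 < d &
    forall v r phi : R, `|v| < d -> 0 <= r <= 1 ->
    let q := glob (pt3 v r phi) in
    [/\ B^-1 <= a1 r phi <= B, `|q 0 0 - a1 r phi * v| <= B * v ^+ 2,
        `|q 0 1 - b0 r phi| <= B * `|v|
      & exists k : int, `|q 0 2 - (c0 r phi + k%:~R)| <= B * `|v|]].
Proof.
move=> g; have [K [d [d0 gK]]] := glob_expansion g.
have gA i r phi : 0 <= r <= 1 -> analytic_at (fun q => glob q 0 i) (pt3 0 r phi).
  by move=> r01; exact: (glob_analytic g).
have [m m0 Hm] : exists2 m : R, 0 < m &
    forall r phi, 0 <= r <= 1 -> 0 <= phi <= 1 -> m <= a1 r phi <= m^-1.
  apply: (a1_two_sided_bound (gA 0) d0 (K := K)).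
    by move=> v r phi vd r01; have [] := gK v r phi vd r01.
  exact: (a1_gt0 g).
have [d1 d10 H1] := analytic3_lipschitz (gA 1).
have [d2 d20 H2] := analytic3_lipschitz (gA 2).
pose B : R := 1 + `|K| + m^-1 + d1^-1 + d2^-1.
have := normr_ge0 K; have := ler_norm K => KK K0.
have mV : 0 < m^-1 by rewrite invr_gt0.
have d1V : 0 < d1^-1 by rewrite invr_gt0.
have d2V : 0 < d2^-1 by rewrite invr_gt0.
exists B, (Num.min d (Num.min d1 d2)); split.
- by rewrite /B; lra.
- by rewrite !lt_min d0 d10.
move=> v r phi; rewrite !lt_min => /andP[vd /andP[vd1 vd2]] r01.
have [k kphi] := exists_mod1 phi.
pose P (t : R) := let q := glob (pt3 v r t) in
    [/\ B^-1 <= a1 r t <= B, `|q 0 0 - a1 r t * v| <= B * v ^+ 2,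
        `|q 0 1 - b0 r t| <= B * `|v|
      & exists k : int, `|q 0 2 - (c0 r t + k%:~R)| <= B * `|v|].
suff : P (phi + k%:~R).
  apply: (iffRL (@int_translate R P _ k phi)) => t.
  rewrite /P /=; have [-> -> [j ->]] := glob_periodic g v r t.
  have [-> -> [l ->]] := coef_periodic g t r01.
  split=> -[h1 h2 h3 [n h4]]; split => //.
  - exists (n + j - l); apply: le_trans h4; rewrite le_eqVlt; apply/orP; left.
    by apply/eqP; congr (`| _ |); rewrite !(intrD, intrN); ring.
  - exists (n - j + l); apply: le_trans h4; rewrite le_eqVlt; apply/orP; left.
    by apply/eqP; congr (`| _ |); rewrite !(intrD, intrN); ring.
set t := phi + _ in kphi *; rewrite /P.
have z0 : `|0 : R| < d by rewrite normr0.
have [_] := gK 0 r t z0 r01; rewrite !expr0n !mulr0 !addr0 !normr_le0 !subr_eq0.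
move=> /eqP b0E /eqP c0E.
have n00 : `|0 - v| <= `|v| by rewrite sub0r normrN.
have rr (s : R) : `|s - s| <= `|v| by rewrite subrr normr0.
have rr' (s c : R) : 0 < c -> `|s - s| < c by rewrite subrr normr0.
have zz (c : R) : 0 < c -> `|0 : R| < c by rewrite normr0.
have [_ h1] := H1 r t v 0 r t `|v| r01 kphi vd1 (zz _ d10)
  (rr' r _ d10) (rr' t _ d10) n00 (rr r) (rr t).
have [_ h2] := H2 r t v 0 r t `|v| r01 kphi vd2 (zz _ d20)
  (rr' r _ d20) (rr' t _ d20) n00 (rr r) (rr t).
split.
- have /andP[a b] := Hm r t r01 kphi; apply/andP; split; last by rewrite /B; lra.
  apply: le_trans a; rewrite -[m]invrK lef_pV2 ?posrE // /B; lra.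
- have [h _ _] := gK v r t vd r01; apply: le_trans h _.
  by rewrite ler_wpM2r ?sqr_ge0 // /B; lra.
- rewrite -b0E; apply: le_trans h1 _.
  by rewrite ler_wpM2r // /B; lra.
- exists 0; rewrite addr0 -c0E; apply: le_trans h2 _.
  by rewrite ler_wpM2r // /B; lra.
Qed.

(** * Asymptotics of the local map *)

Lemma ler_norm_ln1D (R : realType) (y : R) :
  `|y| <= 1 / 2 -> `|ln (1 + y)| <= 2 * `|y|.
Proof.
move=> y2; have y2' := y2; rewrite ler_norml in y2'; case/andP: y2' => ya yb.
have y1 : 0 < 1 + y by lra.
have up : ln (1 + y) <= y by apply: le_ln1Dx; lra.
have low : - ln (1 + y) <= - (y / (1 + y)).
  rewrite -lnV ?posrE //.
  have -> : ln (1 + y)^-1 = ln (1 + - (y / (1 + y))).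
    by congr ln; field; rewrite gt_eqF.
  apply: le_ln1Dx; rewrite ltrN2 ltr_pdivrMr //; lra.
have : `|y / (1 + y)| <= 2 * `|y|.
  rewrite normrM mulrC ler_wpM2r // normfV gtr0_norm //.
  by rewrite -[2]invrK lef_pV2 ?posrE ?invr_gt0 //; lra.
by have := ler_norm y; rewrite !ler_norml => ? /andP[? ?]; apply/andP; split; lra.
Qed.

Lemma ler_norm_ln (R : realType) (a A : R) :
  1 <= A -> A^-1 <= a <= A -> `|ln a| <= A.
Proof.
move=> A1 /andP[aA Aa]; have A0 : 0 < A by lra.
have a0 : 0 < a by apply: lt_le_trans aA; rewrite invr_gt0.
have lnle (y : R) : 0 < y -> ln y <= y - 1.
  move=> y0; have -> : ln y = ln (1 + (y - 1)) by rewrite addrC subrK.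
  by apply: le_ln1Dx; lra.
have aV : a^-1 <= A by rewrite -[A]invrK lef_pV2 ?posrE ?invr_gt0.
have := lnle a a0; have := lnle a^-1; rewrite invr_gt0 lnV ?posrE // => /(_ a0).
by rewrite ler_norml => ? ?; apply/andP; split; lra.
Qed.

(** The point is that the error in V is quadratic in v while V itself is of order
    v: the relative error, hence the error in ln V, is O(v). *)
Lemma log_perturbation (R : realType) (A a v V : R) :
  1 <= A -> A^-1 <= a <= A -> 0 < v -> 2 * A ^+ 2 * v <= 1 ->
  `|V - a * v| <= A * v ^+ 2 ->
  [/\ 0 < V, V <= 2 * A * v & `|ln V - (ln v + ln a)| <= 2 * A ^+ 2 * v].
Proof.
move=> A1 /andP[aA aA2] v0 vA Vv; have A0 : 0 < A by lra.
have a0 : 0 < a by apply: lt_le_trans aA; rewrite invr_gt0.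
have av0 : 0 < a * v by rewrite mulr_gt0.
pose y : R := V / (a * v) - 1.
have VE : V = a * v * (1 + y) by rewrite /y addrC subrK mulrC divfK // gt_eqF.
have yA : `|y| <= A ^+ 2 * v.
  have -> : y = (V - a * v) / (a * v) by rewrite /y mulrBl divff // gt_eqF.
  rewrite normrM normfV (gtr0_norm av0) ler_pdivrMr //.
  apply: le_trans Vv _.
  have -> : A ^+ 2 * v * (a * v) = A * (A * a) * v ^+ 2 by ring.
  rewrite ler_wpM2r ?sqr_ge0 // ler_peMr ?(ltW A0) //.
  by rewrite -ler_pdivrMl // mulr1.
have y2 : `|y| <= 1 / 2 by lra.
have lny := ler_norm_ln1D y2.
move: y2; rewrite ler_norml => /andP[ya yb].
have y0 : 0 < 1 + y by lra.
rewrite VE; split; first exact: mulr_gt0.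
  have -> : 2 * A * v = A * v * 2 by ring.
  apply: ler_pM; [exact: ltW | exact: ltW | | lra].
  by rewrite ler_wpM2r // ltW.
rewrite !lnM ?posrE //.
have -> : ln a + ln v + ln (1 + y) - (ln v + ln a) = ln (1 + y) by ring.
by lra.
Qed.

Lemma passage_time_perturbation (R : realType) (B p T E l L D : R) :
  0 < B -> B^-1 <= p -> `|l - p * T| <= E -> `|l - L| <= D ->
  `|T - L / p| <= B * (E + D).
Proof.
move=> B0 pB lT lL; have p0 : 0 < p by apply: lt_le_trans pB; rewrite invr_gt0.
have pTL : `|p * (T - L / p)| <= E + D.
  have -> : p * (T - L / p) = (l - L) - (l - p * T) by field; rewrite gt_eqF.
  by apply: le_trans (ler_normB _ _) _; rewrite addrC lerD.
rewrite -(ler_pM2l p0) -{1}(gtr0_norm p0) -normrM; apply: le_trans pTL _.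
rewrite mulrA ler_peMl -?ler_pdivrMr ?div1r //.
by rewrite addr_ge0 // (le_trans _ lT, le_trans _ lL).
Qed.

(** Here q = (V, r, phi) is the entry point, with V = a * v2, r = b and phi = c up
    to the errors allowed for the global map at v2 = h * exp z.  The number t is
    the leading part of the passage time: the time v1 = V would take to reach h
    at the constant rate p(b). *)
Lemma passage_asymptotics (R : realType) (S : coefs R) (B d h A : R) :
  local_bounds S B d -> 0 < h <= d -> 1 <= A ->
  exists eps C : R, [/\ 0 < eps, 0 <= C &
    forall (z a b c : R) (q q' : 'rV[R]_3),
    z <= -1 -> expR z <= eps -> A^-1 <= a <= A -> 0 <= b <= 1 ->
    `|q 0 0 - a * (h * expR z)| <= A * (h * expR z) ^+ 2 ->
    `|q 0 1 - b| <= A * (h * expR z) -> `|q 0 2 - c| <= A * (h * expR z) ->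
    passage S h q q' ->
    let t := - (z + ln a) / p S b in
    [/\ 0 < q' 0 0, `|q' 0 1 - b| <= C * expR z,
        `|ln (q' 0 0 / h) - sg S b * t| <= C * (`|z| * expR z),
        `|ln (q' 0 0 / h)| <= C * `|z|
      & exists k : int, `|q' 0 2 - (c + omega S b * t + k%:~R)|
                          <= C * (`|z| * expR z)]].
Proof.
move=> lb hd A1; have [h0 _] := andP hd.
have d0 := lb_d lb.
have A0 : 0 < A := lt_le_trans ltr01 A1.
have B0 : 0 < B := lt_le_trans ltr01 (lb_B lb).
have BV : 0 < B^-1 by rewrite invr_gt0.
have Ah : 0 < A * h by rewrite mulr_gt0.
have pos (x y : R) : 0 < x -> 0 < y -> 0 < x * y := @mulr_gt0 R x y.
(* C0 bounds u(0), C1 the displacement of r and C2 the error in the rates, in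
   units of e = exp z; C3 * e bounds the error in ln V; C4 * |z| bounds the
   passage time; C5 and C6 bound the accumulated errors, those of the rates and
   those of the time, in units of |z| * e. *)
have [C0 C0_gt0 C0E] : exists2 x, 0 < x & x = 2 * A * h * h.
  by eexists; [|reflexivity]; rewrite !mulr_gt0.
have [C1 C1_gt0 C1E] : exists2 x, 0 < x & x = A * h + B ^+ 2 * C0.
  by eexists; [|reflexivity]; rewrite addr_gt0 ?mulr_gt0 ?exprn_gt0.
have [C2 C2_gt0 C2E] : exists2 x, 0 < x & x = B * C1 + B * C0.
  by eexists; [|reflexivity]; rewrite addr_gt0 ?mulr_gt0.
have [C3 C3_gt0 C3E] : exists2 x, 0 < x & x = 2 * A ^+ 2 * h.
  by eexists; [|reflexivity]; rewrite !mulr_gt0 ?exprn_gt0.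
have [C4 C4_gt0 C4E] : exists2 x, 0 < x & x = B * (1 + A + C3).
  by eexists; [|reflexivity]; rewrite mulr_gt0 // !addr_gt0.
have [C5 C5_gt0 C5E] : exists2 x, 0 < x & x = C2 * C4.
  by eexists; [|reflexivity]; rewrite mulr_gt0.
have [C6 C6_gt0 C6E] : exists2 x, 0 < x & x = B * (B * (C5 + C3)).
  by eexists; [|reflexivity]; rewrite !mulr_gt0 // addr_gt0.
have [C [C_gt0 C1C C56 C54]] : exists C, [/\ 0 < C, C1 <= C,
    C5 + A * h + C6 <= C & C5 + B * C4 <= C].
  have BC4 := pos _ _ B0 C4_gt0.
  by exists (C1 + C5 + A * h + C6 + B * C4); split; lra.
exists (Num.min C3^-1 (d / C1)), C; split; [|exact: ltW|].
  by rewrite lt_min invr_gt0 C3_gt0 divr_gt0.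
move=> z a b c q q' z1; rewrite le_min => /andP[eC3 eC1] aA b01 qa qb qc.
case=> T [x [T0 traj near x0 [xT0 xT1 xT2 [j xT3]]]] t.
set e := expR z in eC3 eC1 qa qb qc *; set s := `|z|.
have sE : s = - z by rewrite /s ler0_norm // (le_trans z1) // lerN10.
have s1 : 1 <= s by rewrite sE lerNr.
have e0 : 0 < e by exact: expR_gt0.
have e1 : e <= 1.
  by rewrite /e -expR0 ler_expR (le_trans z1) // lerN10.
have s0 : 0 < s := lt_le_trans ltr01 s1.
have se0 : 0 < s * e := pos _ _ s0 e0.
have ese : e <= s * e by rewrite ler_peMl // ltW.
have ses : s * e <= s by rewrite ler_piMr // ltW.
have v0 : 0 < h * e := pos _ _ h0 e0.
have C3e : 2 * A ^+ 2 * (h * e) = C3 * e by rewrite C3E; ring.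
have [q0 qh lnq] : [/\ 0 < q 0 0, q 0 0 <= 2 * A * (h * e)
    & `|ln (q 0 0) - (ln (h * e) + ln a)| <= C3 * e].
  rewrite -C3e; apply: log_perturbation => //.
  by rewrite C3e mulrC -ler_pdivlMr // div1r.
have {}qh : q 0 0 * h <= C0 * e.
  have -> : C0 * e = 2 * A * (h * e) * h by rewrite C0E; ring.
  by rewrite ler_wpM2r // ltW.
have lnhe : ln (h * e) = ln h + z by rewrite lnM ?posrE // expRK.
have DC1 : `|q 0 1 - b| + B ^+ 2 * (q 0 0 * h) <= C1 * e.
  rewrite C1E mulrDl; apply: lerD; first by rewrite -mulrA.
  by rewrite -[leRHS]mulrA ler_wpM2l // exprn_ge0 // ltW.
have C1d : C1 * e <= d by rewrite mulrC -ler_pdivlMr.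
have [] := trajectory_estimates lb hd T0 traj near x0 q0 b01 (le_trans DC1 C1d).
set D := `|q 0 1 - b| + _ in DC1 *; set E := B * D + _.
rewrite xT0; set l := ln h - _ => -[w1 w2 w3] [w4 w5 w6].
have EC2 : E <= C2 * e.
  by rewrite /E C2E mulrDl; apply: lerD; rewrite -mulrA ler_wpM2l // ltW.
have [pB sgB omB pV] := lb_size lb b01.
have lz : `|l - - (z + ln a)| <= C3 * e.
  move: lnq; rewrite lnhe -normrN; congr (`|_| <= _); rewrite /l; ring.
have ls : l <= (1 + A + C3) * s.
  have lz1 : l <= - z - ln a + C3 * e.
    by move: (le_trans (ler_norm _) lz); rewrite lerBlDl opprD.
  apply: le_trans lz1 _; rewrite !mulrDl mul1r -sE; apply: lerD.
    rewrite lerD2l; have := ler_norm_ln A1 aA; rewrite -normrN => lnA.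
    apply: le_trans (le_trans (ler_norm _) lnA) _.
    by rewrite ler_peMr // ltW.
  by rewrite ler_pM2l // (le_trans e1).
have TC4 : T <= C4 * s.
  by apply: le_trans w3 _; rewrite C4E -mulrA ler_pM2l.
have ET : E * T <= C5 * (s * e).
  have -> : C5 * (s * e) = C2 * e * (C4 * s) by rewrite C5E; ring.
  apply: (@le_trans _ _ (C2 * e * T)); first by rewrite ler_wpM2r.
  by rewrite ler_wpM2l // ltW // pos.
have Tt : B * `|T - t| <= C6 * (s * e).
  have := passage_time_perturbation B0 pV (le_trans w4 ET) lz; rewrite -/t => Tt.
  have -> : C6 * (s * e) = B * (B * (C5 * (s * e) + C3 * (s * e))).
    by rewrite C6E; ring.
  rewrite ler_pM2l //; apply: le_trans Tt _.
  by rewrite ler_pM2l // lerD2l ler_pM2l.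
have mulTt (f : R) : `|f| <= B -> `|f * T - f * t| <= C6 * (s * e).
  move=> fB; rewrite -mulrBr normrM; apply: le_trans Tt.
  by rewrite ler_wpM2r.
have {}C56 : C5 * (s * e) + A * h * (s * e) + C6 * (s * e) <= C * (s * e).
  by rewrite -!mulrDl ler_pM2r.
have qcse : `|q 0 2 - c| <= A * h * (s * e).
  by apply: le_trans qc _; rewrite mulrA ler_pM2l.
rewrite -xT1 -xT2 lnM ?posrE ?invr_gt0 // lnV ?posrE //; split.
- by [].
- apply: le_trans w2 _; apply: le_trans DC1 _; by rewrite ler_pM2r.
- have -> : ln (x T 0 1) + - ln h - sg S b * t =
    (ln (x T 0 1) - ln h - sg S b * T) + (sg S b * T - sg S b * t) by ring.
  apply: le_trans (ler_normD _ _) _; apply: le_trans C56.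
  apply: lerD (mulTt _ sgB); apply: le_trans w5 _; apply: le_trans ET _.
  by rewrite lerDl ltW // pos.
- have -> : ln (x T 0 1) + - ln h = (ln (x T 0 1) - ln h - sg S b * T) + sg S b * T.
    by ring.
  apply: le_trans (ler_normD _ _) _.
  apply: (@le_trans _ _ ((C5 + B * C4) * s)); last by rewrite ler_pM2r.
  rewrite mulrDl; apply: lerD.
    by apply: le_trans w5 _; apply: le_trans ET _; rewrite ler_pM2l.
  by rewrite normrM -mulrA; apply: ler_pM => //; rewrite ger0_norm.
exists (- j).
have -> : q' 0 2 - (c + omega S b * t + (- j)%:~R) =
  (x T 0 3 - q 0 2 - omega S b * T) + (q 0 2 - c)
  + (omega S b * T - omega S b * t) by rewrite xT3 intrN; ring.
apply: le_trans (ler_normD _ _) _; apply: le_trans C56; apply: lerD (mulTt _ omB).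
apply: le_trans (ler_normD _ _) _; apply: lerD qcse.
exact: le_trans w6 ET.
Qed.

(** * The return map *)

(** The radius r of the image point may leave [0, 1]; the smallness of |r - b|
    keeps p(r) at least half of the lower bound for p(b). *)
Lemma alpha_lipschitz (R : realType) (S : coefs R) (B d b r : R) :
  local_bounds S B d -> 0 <= b <= 1 -> `|r - b| <= d ->
  2 * B ^+ 2 * `|r - b| <= 1 ->
  `|alpha S b| <= B ^+ 2 /\ `|alpha S r - alpha S b| <= 4 * B ^+ 4 * `|r - b|.
Proof.
move=> lb b01 rd rB; have B1 := lb_B lb; have B0 : 0 < B by lra.
have [pB _ omB pV] := lb_size lb b01; have [pL _ omL] := lb_lip lb b01 rd.
have BV : 0 < B^-1 by rewrite invr_gt0.
have p0 : 0 < p S b by lra.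
set e := `|r - b| in rd rB pL omL *.
have Be : B * e <= B^-1 / 2.
  rewrite -(ler_pM2l B0); have -> : B * (B^-1 / 2) = 1 / 2 by field; rewrite gt_eqF.
  by move: rB; rewrite expr2; lra.
have pr : B^-1 / 2 <= p S r.
  by move: (le_trans pL Be); rewrite ler_norml => /andP[+ _]; lra.
have pr0 : 0 < p S r by lra.
have pbV : (p S b)^-1 <= B.
  by rewrite -[B]invrK lef_pV2 ?posrE.
have prV : (p S r)^-1 <= 2 * B.
  rewrite -[2 * B]invrK lef_pV2 ?posrE ?invr_gt0 ?mulr_gt0 // invfM; lra.
split.
  rewrite /alpha normrM normrN normfV (gtr0_norm p0) expr2.
  by apply: ler_pM => //; rewrite invr_ge0 ltW.
have -> : alpha S r - alpha S b =
    ((p S r - p S b) * omega S b - (omega S r - omega S b) * p S b)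
    * ((p S r)^-1 * (p S b)^-1).
  by rewrite /alpha; field; rewrite !gt_eqF.
have -> : 4 * B ^+ 4 * e = (B * e * B + B * e * B) * (2 * B * B) by ring.
rewrite normrM; apply: ler_pM => //.
  apply: le_trans (ler_normB _ _) _; apply: lerD; rewrite normrM; exact: ler_pM.
rewrite ger0_norm; last by rewrite mulr_ge0 // invr_ge0 ltW.
by apply: ler_pM => //; rewrite invr_ge0 ltW.
Qed.

(* The radius at which the local passage takes place is b0 r phi at leading
   order; Z is the logarithmic variable rescaled there.  The image variable is
   rescaled at the radius of the image point. *)
Theorem proposition8 (R : realType) (S : coefs R) (hS : normal_form S) :
  exists h0 : R, 0 < h0 /\
  forall (h : R) (glob loc : 'rV[R]_3 -> 'rV[R]_3) (W : set 'rV[R]_3)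
      (a1 b0 b1 c0 c1 : R -> R -> R),
    0 < h < h0 ->
    global_map glob a1 b0 b1 c0 c1 ->
    local_map S h W loc ->
    (exists d : R, 0 < d /\ forall v2 r phi : R,
       0 < v2 < d -> 0 <= r <= 1 -> W (glob (pt3 v2 r phi))) ->
  exists z0 C : R, forall z r phi : R, z < z0 -> 0 <= r <= 1 ->
    let w := return_map h loc glob (pt3 z r phi) in
    let Z := rescale S (b0 r phi) z in
    let Z' := rescale S (w 0 1) (w 0 0) in
    [/\ 0 < (loc \o glob \o of_log h) (pt3 z r phi) 0 0,
        `|Z' - (Omega S a1 b0 r phi + Gamma S b0 r phi * Z)|
          <= C * (`|z| * expR z),
        `|w 0 1 - b0 r phi| <= C * expR z
      & exists k : int,
          `|w 0 2 - (c_shift S a1 b0 c0 r phi + Z + k%:~R)|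
            <= C * (`|z| * expR z)].
Proof.
have [B [d lb]] := normal_form_local_bounds hS.
have B1 := lb_B lb; have d0 := lb_d lb; have B0 : 0 < B by lra.
exists d; split=> // h glob loc W a1 b0 b1 c0 c1 /andP[h0 hd] gm lm [dW [dW0 HW]].
have [A [dg [A1 dg0 gB]]] := global_map_bounds gm.
have hd' : 0 < h <= d by rewrite h0 ltW.
have [eps [C [eps0 C0 pass]]] := passage_asymptotics lb hd' A1.
pose C' := C + 1; have C'0 : 0 < C' by rewrite /C'; lra.
have BC' : 0 < 2 * B ^+ 2 * C' by rewrite !mulr_gt0 ?exprn_gt0.
pose e1 := Num.min (Num.min eps (Num.min (dg / h) (dW / h)))
  (Num.min (d / C') (2 * B ^+ 2 * C')^-1).
have e10 : 0 < e1 by rewrite !lt_min eps0 !divr_gt0 // invr_gt0.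
have B2 : 0 <= B ^+ 2 by rewrite exprn_ge0 // ltW.
have B4 : 0 <= 4 * B ^+ 4 by apply: mulr_ge0 => //; rewrite exprn_ge0 // ltW.
pose K := 4 * B ^+ 4 * C * C + B ^+ 2 * C.
have K0 : 0 <= K.
  apply: addr_ge0; last exact: mulr_ge0.
  by apply: mulr_ge0 => //; exact: mulr_ge0.
exists (Num.min (-1) (ln e1)), (K + C) => z r phi; rewrite lt_min => /andP[z1 ze1] r01.
have e0 : 0 < expR z := expR_gt0 z.
have : expR z < e1 by rewrite -[e1]lnK ?posrE // ltr_expR.
rewrite !lt_min => /andP[/andP[eeps /andP[edg edW]] /andP[ed eB]].
have v0 : 0 < h * expR z by rewrite mulr_gt0.
have vdg : `|h * expR z| < dg by rewrite gtr0_norm // mulrC -ltr_pdivlMr.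
have vdW : 0 < h * expR z < dW by rewrite v0 mulrC -ltr_pdivlMr.
have -> : return_map h loc glob (pt3 z r phi)
    = to_log h (loc (glob (pt3 (h * expR z) r phi))).
  by rewrite /return_map /= /of_log !mxE.
have -> : (loc \o glob \o of_log h) (pt3 z r phi)
    = loc (glob (pt3 (h * expR z) r phi)).
  by rewrite /= /of_log !mxE.
have [aA qa qb [k qc]] := gB _ _ phi vdg r01.
have b01 := b0_itv gm phi r01.
have P := lm _ (HW _ _ phi vdW r01).
set q := glob _ in qa qb qc P *; set q' := loc q in P *.
rewrite (gtr0_norm v0) in qb qc.
have [w0 w1 w2 w3 [j w4]] := pass z (a1 r phi) (b0 r phi)
  (c0 r phi + k%:~R) q q' (ltW z1) (ltW eeps) aA b01 qa qb qc P.
move=> w Z Z'.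
set b := b0 r phi in b01 w1 w2 w4 Z *; set a := a1 r phi in w2 w4.
set t := - (z + ln a) / p S b in w2 w4.
have w00 : w 0 0 = ln (q' 0 0 / h) by rewrite mxE.
have w01 : w 0 1 = q' 0 1 by rewrite mxE.
have w02 : w 0 2 = q' 0 2 by rewrite mxE.
have pb0 : 0 < p S b by have [] := nf_signs hS b01.
have se0 : 0 <= `|z| * expR z by rewrite mulr_ge0 // ltW.
split; first exact: w0.
- have e1' : C * expR z <= C' * expR z by rewrite ler_wpM2r ?(ltW e0) // /C'; lra.
  have [||al1 al2] := alpha_lipschitz lb b01 (r := q' 0 1).
  + apply: le_trans w1 _; apply: le_trans e1' _.
    by rewrite mulrC -ler_pdivlMr // ltW.
  + apply: (@le_trans _ _ (2 * B ^+ 2 * (C' * expR z))).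
      rewrite ler_wpM2l ?mulr_ge0 ?exprn_ge0 ?(ltW B0) //.
      exact: le_trans e1'.
    by rewrite mulrA mulrC -ler_pdivlMr // div1r ltW.
  have -> : Z' - (Omega S a1 b0 r phi + Gamma S b0 r phi * Z) =
      (alpha S (q' 0 1) - alpha S b) * ln (q' 0 0 / h)
      + alpha S b * (ln (q' 0 0 / h) - sg S b * t).
    rewrite /Z' /Z /rescale w00 w01 /Omega /Gamma -/b -/a /t.
    have -> : alpha S b = - omega S b / p S b by [].
    by field; rewrite gt_eqF.
  apply: le_trans (ler_normD _ _) _; rewrite normrM (normrM (alpha S b)).
  have m1 : `|alpha S (q' 0 1) - alpha S b| * `|ln (q' 0 0 / h)|
      <= 4 * B ^+ 4 * (C * expR z) * (C * `|z|).
    apply: ler_pM => //; apply: le_trans al2 _.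
    by rewrite ler_wpM2l.
  have m2 : `|alpha S b| * `|ln (q' 0 0 / h) - sg S b * t|
      <= B ^+ 2 * (C * (`|z| * expR z)) by apply: ler_pM.
  apply: le_trans (lerD m1 m2) _.
  have -> : (K + C) * (`|z| * expR z) = 4 * B ^+ 4 * (C * expR z) * (C * `|z|)
    + B ^+ 2 * (C * (`|z| * expR z)) + C * (`|z| * expR z) by rewrite /K; ring.
  by rewrite lerDl mulr_ge0.
- rewrite w01; apply: le_trans w1 _; rewrite ler_wpM2r ?(ltW e0) //; lra.
(* k comes from the angle of glob, j from the angle of the local passage *)
exists (k + j); rewrite w02.
have -> : c_shift S a1 b0 c0 r phi + Z + (k + j)%:~R
    = c0 r phi + k%:~R + omega S b * t + j%:~R.
  by rewrite /c_shift /Z /rescale /alpha /t -/b -/a intrD; field; rewrite gt_eqF.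
by apply: le_trans w4 _; rewrite ler_wpM2r //; lra.
Qed.
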